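(* Let $q=mf+1$ be a power of a prime $p$, with $m,f$ positive integers. Suppose $f-1=\lambda m$ with $\lambda$ a nonnegative integer, and let $\chi$ be a multiplicative character of order $m$ on $\mathbb{F}_q$. Then $H_{q,m}$ is a $(q,f,\lambda)$-difference set in $\mathbb{F}_q$ if and only if $$\sum_{\substack{t=1\\ t\neq s}}^{m-1}\chi^t(-1)G_q(\chi^t)G_q(\chi^{s-t})=(1+\chi^s(-1))G_q(\chi^s),\quad s=1,\dots,m-1.$$
   Context: $H_{q,m}$ denotes the set of nonzero $m$th powers in $\mathbb{F}_q$. A subset $D\subseteq\mathbb{F}_q$ of size $k$ is a $(q,k,\lambda)$-difference set in $\mathbb{F}_q$ if for each nonzero $a\in\mathbb{F}_q$ there are exactly $\lambda$ ordered pairs $(x,y)\in D\times D$ with $x-y=a$. A multiplicative character on $\mathbb{F}_q$ is a homomorphism $\mathbb{F}_q^*\to\mathbb{C}^*$ extended to $0$ by the value $1$ if the character is trivial and $0$ if it is nontrivial. For $s\in\mathbb{Z}$, $\chi^s$ is the $s$th power of $\chi$ as a character of $\mathbb{F}_q^*$, extended to $0$ by this same rule. The Gauss sum of a multiplicative character $\chi$ on $\mathbb{F}_q$ is $G_q(\chi)=\sum_{\alpha\in\mathbb{F}_q}\chi(\alpha)\zeta_p^{\mathrm{tr}(\alpha)}$, where $\zeta_p=e^{2\pi i/p}$ and $\mathrm{tr}$ is the trace map from $\mathbb{F}_q$ to $\mathbb{F}_p$. *)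

(* Defs.v *)
From HB Require Import structures.
From mathcomp Require Import all_boot all_order all_algebra all_field.
From mathcomp Require Import complex.
From mathcomp Require Import reals trigo.

Set Implicit Arguments.
Unset Strict Implicit.
Unset Printing Implicit Defensive.

Import Order.TTheory GRing.Theory Num.Theory.

Local Open Scope ring_scope.
Local Open Scope complex_scope.

Section DifferenceSets.
Variable F : finFieldType.

Definition nz_powers (m : nat) : {set F} := [set x ^+ m | x : F & x != 0].

Definition is_difference_set (k lambda : nat) (D : {set F}) : Prop :=
  #|D| = k /\
  forall a : F, a != 0 ->
    #|[set xy : F * F | [&& xy.1 \in D, xy.2 \in D & xy.1 - xy.2 == a]]|
      = lambda.

End DifferenceSets.

Section MultiplicativeCharacters.
Variables (F : finFieldType) (C : fieldType).
Implicit Type chi : F -> C.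

Definition mchar_trivial chi : bool := [forall x, (x != 0) ==> (chi x == 1)].

(* Only the values of chi on nonzero elements matter. *)
Definition mchar_ext0 chi : F -> C :=
  fun x => if x == 0 then (if mchar_trivial chi then 1 else 0) else chi x.

Definition is_mchar chi : Prop :=
  [/\ {in predC1 0 &, {morph chi : x y / x * y}},
      forall x, x != 0 -> chi x != 0
    & chi 0 = if mchar_trivial chi then 1 else 0].

Definition mchar_exp chi (s : int) : F -> C :=
  mchar_ext0 (fun x => chi x ^ s).

Definition mchar_has_order chi (m : nat) : Prop :=
  [/\ (0 < m)%N, mchar_trivial (mchar_exp chi m)
    & forall k : nat, (0 < k < m)%N -> ~~ mchar_trivial (mchar_exp chi k)].

End MultiplicativeCharacters.

Section Trace.
Variables (F : finFieldType) (p : nat) (charFp : p \in [pchar F]).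
Local Notation L := (pPrimeCharType charFp).

(* The trace takes values in the prime subfield 1%AS of L. To use it as an    *)
(* exponent we take its preimage under the embedding c |-> c%:A of 'F_p in L; *)
(* by absolute_traceE the default value 0 is never used.                      *)
Definition absolute_trace (x : F) : 'F_p :=
  odflt 0 [pick c : 'F_p | c%:A == galTrace 1%AS {:L}%AS (x : L)].

Lemma absolute_traceE (x : F) :
  (absolute_trace x)%:A = galTrace 1%AS {:L}%AS (x : L).
Proof.
rewrite /absolute_trace; case: pickP => [c /eqP //|noc].
have /vlineP[c Dc] : galTrace 1%AS {:L}%AS (x : L) \in 1%AS.
  by apply: mem_galTrace; rewrite ?memvf // finField_galois ?sub1v.
by have := noc c; rewrite Dc eqxx.
Qed.

End Trace.

(* e^(2 pi i / p) *)
Definition zeta (R : realType) (p : nat) : R[i] :=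
  cos (2 * pi / p%:R) +i* sin (2 * pi / p%:R).

(* As c : 'F_p has a natural number value in [0, p), zeta ^+ c is the power   *)
(* of the p-th root of unity zeta by any representative of c.                 *)
Definition gauss_sum (R : realType) (F : finFieldType) (p : nat)
    (charFp : p \in [pchar F]) (chi : F -> R[i]) : R[i] :=
  \sum_(a : F) chi a * zeta R p ^+ absolute_trace charFp a.

(* Main.v *)
Require Import Defs.
From HB Require Import structures.
From mathcomp Require Import all_boot all_order all_algebra all_field.
From mathcomp Require Import complex.
From mathcomp Require Import reals trigo.
From mathcomp Require Import fingroup cyclic ring zify.

Set Implicit Arguments.
Unset Strict Implicit.
Unset Printing Implicit Defensive.

Import Order.TTheory GRing.Theory Num.Theory.
Local Open Scope ring_scope.
Local Open Scope complex_scope.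

(** Let H be the group of nonzero m-th powers; it is the kernel of chi and has
f elements. Everything is compared with the sums
  T s = sum over h in H of 1 / chi^s(1 - h),     0 < s < m.

On the side of the difference set: a difference x - y = a with x, y in H is
determined by h = y / x, and exists for a given h != 1 in H exactly when
chi (1 - h) = chi a. So the number N a of representations of a is the number
of such h. Orthogonality of the powers of chi turns this into
  m * N a = (f - 1) + sum_(0 < s < m) chi a ^ s * T s
([difference_count_expansion]), a Fourier expansion over the quotient of the
multiplicative group by H whose nonconstant coefficients are the T s. Hence N
is constant, necessarily with value (f - 1) / m = lambda, exactly when all the
T s vanish ([difference_set_shifted_char_sum]).

On the side of the Gauss sums: let G* be the Gauss sum restricted to nonzero
arguments. It agrees with G on nontrivial characters, while G* of the trivial
character is -1. Substituting x = - y h in a product of two such sums gives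
  chi^t(-1) G*(chi^t) G*(chi^(s-t))
    = G(chi^s) * sum over h != 0 of chi^t(h) / chi^s(1 - h)
([gauss_sum_product]), and summing over all t modulo m restricts h to H, so
the total is m * G(chi^s) * T s. The terms t = 0 and t = s of that sum are
-G(chi^s) and -chi^s(-1) G(chi^s), so the total is also the difference of the
two sides of the s-th equation ([gauss_sum_identity]).

Since G(chi^s) != 0 ([gauss_sum_neq0]), the s-th equation says precisely that
T s = 0. The Gauss sum argument works for any nontrivial additive character;
the last part checks that x |-> zeta ^ tr x is one. *)

(** * Multiplicative characters *)

Lemma finField_generator (F : finFieldType) :
  exists2 g : F, g != 0 & forall x : F, x != 0 -> exists i : nat, x = g ^+ i.
Proof.
pose n := #|F|.-1; pose rs := enum (predC1 (0 : F)).
have n_gt0 : (0 < n)%N.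
  by rewrite /n -ltnS prednK ?finNzRing_gt1 // ltnW ?finNzRing_gt1.
have unit_n x : x != 0 :> F -> x ^+ n = 1.
  move=> x0; apply: (mulfI x0); rewrite -exprS mulr1 prednK ?expf_card //.
  by rewrite ltnW ?finNzRing_gt1.
have : has n.-primitive_root rs.
  apply: has_prim_root => //; last by rewrite -cardE cardC1.
    by apply/allP => x; rewrite mem_enum !inE unity_rootE => /unit_n ->.
  by rewrite /rs enum_uniq.
case/hasP => g; rewrite mem_enum !inE => g0 prim_g; exists g => // x.
by move=> /unit_n /(prim_rootP prim_g)[i ->]; exists i.
Qed.

Section MultiplicativeCharacter.
Variables (F : finFieldType) (C : fieldType) (chi : F -> C).
Hypothesis chiP : is_mchar chi.

Lemma mcharM x y : x != 0 -> y != 0 -> chi (x * y) = chi x * chi y.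
Proof. by case: chiP => chiM _ _ x0 y0; apply: chiM. Qed.

Lemma mchar_neq0 x : x != 0 -> chi x != 0.
Proof. by case: chiP => _ + _; apply. Qed.

Lemma mchar1 : chi 1 = 1.
Proof.
have := mcharM (oner_neq0 F) (oner_neq0 F); rewrite mulr1 => chi11.
apply: (mulfI (mchar_neq0 (oner_neq0 F))).
by rewrite -chi11 mulr1.
Qed.

Lemma mcharV x : x != 0 -> chi x^-1 = (chi x)^-1.
Proof.
move=> x0; apply: (mulfI (mchar_neq0 x0)).
by rewrite -mcharM ?invr_eq0 // !mulfV ?mchar_neq0 // mchar1.
Qed.

Lemma mchar_div x y : x != 0 -> y != 0 -> chi (x / y) = chi x / chi y.
Proof. by move=> x0 y0; rewrite mcharM ?invr_eq0 // mcharV. Qed.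

Lemma mcharXn x n : x != 0 -> chi (x ^+ n) = chi x ^+ n.
Proof.
move=> x0; elim: n => [|n IH]; first by rewrite !expr0 mchar1.
by rewrite !exprS mcharM ?expf_neq0 // IH.
Qed.

Lemma mchar_expE s x : x != 0 -> mchar_exp chi s x = chi x ^ s.
Proof. by rewrite /mchar_exp /mchar_ext0 => /negPf ->. Qed.

Lemma mchar_exp_trivial s :
  mchar_trivial (mchar_exp chi s) = [forall x, (x != 0) ==> (chi x ^ s == 1)].
Proof.
apply: eq_forallb => x; case: eqVneq => //= x0; by rewrite mchar_expE.
Qed.

Lemma mchar_exp_mchar s : is_mchar (mchar_exp chi s).
Proof.
split=> [x y|x x0|].
- rewrite !inE => x0 y0; rewrite !mchar_expE ?mulf_neq0 //.
  by rewrite mcharM // expfzMl.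
- by rewrite mchar_expE // expfz_neq0 ?mchar_neq0.
- by rewrite {1}/mchar_exp /mchar_ext0 eqxx mchar_exp_trivial.
Qed.

Hypothesis chi_nontrivial : ~~ mchar_trivial chi.

Lemma nontrivial_mchar0 : chi 0 = 0.
Proof. by case: chiP => _ _ ->; rewrite (negPf chi_nontrivial). Qed.

Lemma nontrivial_mcharM : {morph chi : x y / x * y}.
Proof.
move=> x y; have [->|x0] := eqVneq x 0.
  by rewrite !(mul0r, nontrivial_mchar0).
have [->|y0] := eqVneq y 0; first by rewrite !(mulr0, nontrivial_mchar0).
exact: mcharM.
Qed.

Lemma nontrivial_mchar_sum : \sum_(x | x != 0) chi x = 0.
Proof.
have /forallPn[a] := chi_nontrivial; rewrite negb_imply => /andP[a0 chia].
have : (chi a - 1) * \sum_(x | x != 0) chi x = 0.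
  rewrite mulrBl mul1r mulr_sumr [X in _ - X](reindex_inj (mulfI a0)) /=.
  apply/eqP; rewrite subr_eq0; apply/eqP; apply: eq_big => x.
    by rewrite mulf_eq0 negb_or a0.
  by move=> x0; rewrite nontrivial_mcharM.
by move/eqP; rewrite mulf_eq0 subr_eq0 (negPf chia) => /eqP.
Qed.

End MultiplicativeCharacter.

(** * Gauss sums for an arbitrary nontrivial additive character *)

Section AdditiveCharacter.
Variables (F : finFieldType) (C : numFieldType) (psi : F -> C).
Hypothesis psiD : {morph psi : x y / x + y >-> x * y}.
Hypothesis psi0 : psi 0 = 1.
Hypothesis psi_nontrivial : exists x, psi x != 1.

Lemma additive_char_sum : \sum_x psi x = 0.
Proof.
have [a psia] := psi_nontrivial.
have : (psi a - 1) * \sum_x psi x = 0.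
  rewrite mulrBl mul1r mulr_sumr [X in _ - X](reindex_inj (addrI a)) /=.
  by under eq_bigr do rewrite -psiD; rewrite subrr.
by move/eqP; rewrite mulf_eq0 subr_eq0 (negPf psia) => /eqP.
Qed.

Definition gen_gauss_sum (chi : F -> C) : C := \sum_x chi x * psi x.

Section GaussSum.
Variable chi : F -> C.
Hypotheses (chiP : is_mchar chi) (chi_nontrivial : ~~ mchar_trivial chi).
Let chi0 := nontrivial_mchar0 chiP chi_nontrivial.

(** The case a = 0 is included: both sides are then 0, the left one by
orthogonality and the right one because chi 0 = 0 and 0^-1 = 0. Dropping the
condition on a is what later lets h = 1 be treated like any other h. *)
Lemma gauss_sum_twist a :
  \sum_x chi x * psi (a * x) = (chi a)^-1 * gen_gauss_sum chi.
Proof.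
have [->|a0] := eqVneq a 0.
  under eq_bigr do rewrite mul0r psi0 mulr1.
  rewrite chi0 invr0 mul0r (bigD1 0) //= chi0 add0r.
  exact: nontrivial_mchar_sum.
rewrite /gen_gauss_sum [in RHS](reindex_inj (mulfI a0)) /= mulr_sumr.
apply: eq_bigr => x _; rewrite (nontrivial_mcharM chiP chi_nontrivial).
by rewrite !mulrA mulVf ?mul1r ?mchar_neq0.
Qed.

(** If the Gauss sum were 0, then by [gauss_sum_twist] the additive Fourier
transform of chi would vanish identically, and Fourier inversion at the point 1
would give #|F| * chi 1 = 0. *)
Lemma gauss_sum_neq0 : gen_gauss_sum chi != 0.
Proof.
apply/eqP => G0.
have: \sum_a psi (- a) * \sum_x chi x * psi (a * x) = 0.
  by rewrite big1 // => a _; rewrite gauss_sum_twist G0 !mulr0.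
under eq_bigr do rewrite mulr_sumr.
rewrite exchange_big /= (bigD1 1) //= [X in _ + X]big1 => [|x x1].
  rewrite addr0 (eq_bigr (fun _ => 1)) => [|a _]; last first.
    by rewrite mchar1 // mul1r mulr1 -psiD addNr.
  by rewrite sumr_const => /eqP; rewrite pnatr_eq0 (cardD1 0).
rewrite (eq_bigr (fun a => chi x * psi ((x - 1) * a))) => [|a _]; last first.
  by rewrite mulrCA -psiD; congr (_ * psi _); ring.
have x10 : x - 1 != 0 by rewrite subr_eq0.
rewrite -mulr_sumr.
have := additive_char_sum; rewrite (reindex_inj (mulfI x10)) /= => ->.
by rewrite mulr0.
Qed.

End GaussSum.
End AdditiveCharacter.

Lemma geometric_unity_sum (C : fieldType) (z : C) (m : nat) :
  z ^+ m = 1 -> \sum_(0 <= t < m) z ^+ t = if z == 1 then m%:R else 0.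
Proof.
move=> zm; rewrite big_mkord; have [->|z1] := eqVneq z 1.
  by under eq_bigr do rewrite expr1n; rewrite sumr_const card_ord.
have := subrX1 z m; rewrite zm subrr => /esym/eqP.
by rewrite mulf_eq0 subr_eq0 (negPf z1) => /eqP.
Qed.

Lemma absz_sub_lt (m s t : nat) :
  (s < m)%N -> (t < m)%N -> s != t -> (0 < `|s%:Z - t%:Z| < m)%N.
Proof.
move=> sm tm st; rewrite absz_gt0 subr_eq0 eqz_nat st /=.
by rewrite -ltz_nat abszE ltr_norml; lia.
Qed.

(** * Power residues and the differences between them *)

Section PowerResidues.
Variables (F : finFieldType) (C : numFieldType) (m f : nat).
Hypothesis cardF : #|F| = (m * f + 1)%N.
Variable chi : F -> C.
Hypotheses (chiP : is_mchar chi) (chi_order : mchar_has_order chi m).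

Local Notation H := (nz_powers F m).
Local Notation e := (mchar_exp chi).

Lemma mchar_order_gt0 : (0 < m)%N.
Proof. by case: chi_order. Qed.

Lemma card_nonzero : #|[pred x : F | x != 0]| = (m * f)%N.
Proof. by rewrite -[RHS](addnK 1%N) -cardF subn1 -(cardC1 (0 : F)). Qed.

Lemma mchar_order_exp x : x != 0 -> chi x ^+ m = 1.
Proof.
move=> x0; case: chi_order => _ + _.
by rewrite mchar_exp_trivial => // /forallP/(_ x); rewrite x0 => /eqP.
Qed.

(** Integer exponents are allowed because the quotient of two distinct powers of
chi is a power with a possibly negative exponent. *)
Lemma mchar_exp_nontrivial (s : int) :
  (0 < `|s| < m)%N -> ~~ mchar_trivial (e s).
Proof.
case: chi_order => _ _ ntriv /ntriv; apply: contra.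
case: (intP s) => // n; rewrite ?abszN //= !mchar_exp_trivial //.
move=> /forallP triv; apply/forallP => x; apply/implyP => x0.
by have := implyP (triv x) x0; rewrite -invr_expz invr_eq1.
Qed.

Lemma mchar_exp_sum (s : int) :
  (0 < `|s| < m)%N -> \sum_(x | x != 0) chi x ^ s = 0.
Proof.
move=> /mchar_exp_nontrivial ntriv.
rewrite -[RHS](nontrivial_mchar_sum (mchar_exp_mchar chiP s) ntriv).
by apply: eq_bigr => x x0; rewrite mchar_expE.
Qed.

(** A power g^i of a generator with chi (g^i) = 1 has m %| i, for otherwise the
remainder of i modulo m would be a smaller exponent killing chi on all powers
of g. *)
Lemma mem_nz_powers x : (x \in H) = (x != 0) && (chi x == 1).
Proof.
apply/imsetP/andP => [[y y0 ->]|[x0 /eqP chix]].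
  by rewrite inE in y0; rewrite expf_neq0 // mcharXn // mchar_order_exp.
have [g g0 gen] := finField_generator F; have [i xi] := gen x x0.
have chigr : chi g ^+ (i %% m) = 1.
  by rewrite expr_mod ?mchar_order_exp // -mcharXn // -xi.
have m_dvd_i : (m %| i)%N.
  rewrite /dvdn -leqn0 leqNgt; apply/negP => r_gt0.
  have r_lt : (i %% m < m)%N by rewrite ltn_mod mchar_order_gt0.
  case: chi_order => _ _ /(_ (i %% m)%N); rewrite r_gt0 r_lt => /(_ isT).
  rewrite mchar_exp_trivial // => /negP; apply.
  apply/forallP => y; apply/implyP => y0; have [j ->] := gen y y0.
  by rewrite mcharXn // -exprnP exprAC chigr expr1n.
exists (g ^+ (i %/ m)); first by rewrite inE expf_neq0.
by rewrite -exprM divnK.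
Qed.

Lemma nz_powers_indicator x :
  x != 0 -> \sum_(0 <= t < m) chi x ^+ t = if x \in H then m%:R else 0.
Proof.
move=> x0; rewrite geometric_unity_sum ?mchar_order_exp //.
by rewrite mem_nz_powers x0.
Qed.

(** Sum [nz_powers_indicator] over all x != 0: only the trivial power of chi
contributes, and it contributes m * f. *)
Lemma card_nz_powers : #|H| = f.
Proof.
have m0 : m%:R != 0 :> C by rewrite pnatr_eq0 -lt0n mchar_order_gt0.
apply/eqP; rewrite -(eqr_nat C) -(inj_eq (mulfI m0)).
rewrite -[eqbRHS]natrM -card_nonzero.
have -> : m%:R * #|H|%:R = \sum_(x : F | x != 0) \sum_(0 <= t < m) chi x ^+ t.
  rewrite -sumr_const mulr_sumr big_mkcond [RHS]big_mkcond /=.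
  apply: eq_bigr => x _; case: ifPn => xH; last first.
    by case: ifP => // x0; rewrite nz_powers_indicator // (negPf xH).
  have x0 : x != 0 by move: xH; rewrite mem_nz_powers => /andP[].
  by rewrite x0 nz_powers_indicator // xH mulr1.
rewrite exchange_big /= big_ltn ?mchar_order_gt0 // [X in _ + X]big1_seq ?addr0.
  by under eq_bigr do rewrite expr0; rewrite sumr_const.
move=> t; rewrite mem_index_iota => /= t_int.
by rewrite -[RHS](@mchar_exp_sum t).
Qed.

(** The term h = 1 is harmless: for 0 < s < m it is 0^-1 = 0. *)
Definition shifted_char_sum (s : nat) : C := \sum_(h in H) (e s (1 - h))^-1.
Local Notation T := shifted_char_sum.

Lemma shifted_char_sumE s : (0 < s < m)%N ->
  T s = \sum_(h in H | h != 1) chi (1 - h) ^- s.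
Proof.
move=> s_int; rewrite /T (bigID (pred1 1)) /=.
rewrite big1 ?add0r => [|h /andP[_ /eqP->]].
  apply: eq_bigr => h /andP[_ h1].
  by rewrite mchar_expE // subr_eq0 eq_sym.
rewrite subrr (nontrivial_mchar0 (mchar_exp_mchar chiP _)) ?invr0 //.
exact: mchar_exp_nontrivial.
Qed.

Definition difference_count (a : F) : nat :=
  #|[set xy : F * F | [&& xy.1 \in H, xy.2 \in H & xy.1 - xy.2 == a]]|.

(** The pair (x, y) corresponds to h = y / x: since x (1 - h) = a, x is
recovered as a / (1 - h), which lies in the kernel of chi exactly when
chi (1 - h) = chi a. *)
Lemma difference_countE a : a != 0 ->
  difference_count a =
    #|[set h in H | (h != 1) && (chi (1 - h) == chi a)]|.
Proof.
move=> a0; pose D h := (a / (1 - h), a / (1 - h) * h).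
rewrite -(card_in_imset (f := D)) => [|h k]; last first.
  rewrite !inE => /and3P[_ h1 _] /and3P[_ k1 _] [/(mulfI a0)/invr_inj].
  by move=> /addrI/oppr_inj.
apply: eq_card => -[x y]; rewrite !inE /=; apply/and3P/imsetP.
  move=> [xH yH /eqP Da]; move: (xH) (yH); rewrite !mem_nz_powers.
  move=> /andP[x0 /eqP chix] /andP[y0 /eqP chiy].
  have Dh : 1 - y / x = a / x by rewrite -Da mulrBl divff.
  exists (y / x).
    rewrite !inE mem_nz_powers mulf_neq0 ?invr_eq0 //= Dh.
    rewrite (mchar_div chiP y0 x0) (mchar_div chiP a0 x0) chix chiy !divr1.
    rewrite !eqxx /=.
    by rewrite andbT eq_sym -subr_eq0 Dh mulf_neq0 ?invr_eq0.
  have xE : a / (a / x) = x by rewrite invfM invrK mulrA divff ?mul1r.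
  by rewrite /D Dh xE mulrCA divff ?mulr1.
move=> [h]; rewrite !inE => /and3P[hH h1 /eqP chih] [-> ->].
have h10 : 1 - h != 0 by rewrite subr_eq0 eq_sym.
have xH : a / (1 - h) \in H.
  rewrite mem_nz_powers mulf_neq0 ?invr_eq0 //= (mchar_div chiP a0 h10) chih.
  by rewrite divff ?mchar_neq0.
move: (xH) (hH); rewrite !mem_nz_powers.
move=> /andP[x0 /eqP chix] /andP[y0 /eqP chiy].
split; first by rewrite x0 chix eqxx.
  by rewrite mulf_neq0 //= (mcharM chiP x0 y0) chix chiy mul1r eqxx.
by rewrite -{1}[a / (1 - h)]mulr1 -mulrBr divfK.
Qed.

(** The condition chi (1 - h) = chi a is detected by a geometric sum in the m-th
root of unity chi a / chi (1 - h). *)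
Lemma difference_count_expansion a : a != 0 ->
  m%:R * (difference_count a)%:R
    = (f - 1)%N%:R + \sum_(1 <= s < m) chi a ^+ s * T s.
Proof.
move=> a0; have one_H : 1 \in H by rewrite mem_nz_powers oner_eq0 mchar1 /=.
have -> : m%:R * (difference_count a)%:R
    = \sum_(h in H | h != 1) \sum_(0 <= t < m) (chi a / chi (1 - h)) ^+ t.
  rewrite difference_countE // -sumr_const mulr_sumr big_mkcond [RHS]big_mkcond.
  apply: eq_bigr => h _; rewrite inE; case: (h \in H) => //=.
  case: eqVneq => //= h1; have h10 : 1 - h != 0 by rewrite subr_eq0 eq_sym.
  rewrite geometric_unity_sum; last first.
    by rewrite expr_div_n !mchar_order_exp // divr1.
  have -> : (chi a / chi (1 - h) == 1) = (chi (1 - h) == chi a).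
    by apply/eqP/eqP => [/divr1_eq->//|->]; rewrite divff ?mchar_neq0.
  by rewrite mulr1.
rewrite exchange_big /= big_ltn ?mchar_order_gt0 //; congr (_ + _).
  under eq_bigr do rewrite expr0.
  rewrite sumr_const; congr _%:R; rewrite -card_nz_powers (cardD1 1 H) one_H.
  by rewrite add1n subn1; apply: eq_card => h; rewrite !inE andbC.
apply: eq_big_nat => s s_int; rewrite shifted_char_sumE // mulr_sumr.
by apply: eq_bigr => h _; rewrite expr_div_n.
Qed.

(** If all T s vanish, the expansion of the difference count reads
m * N a = f - 1. Conversely, T r is recovered from a constant count as its
r-th Fourier coefficient. *)
Lemma difference_set_shifted_char_sum lambda :
  (f - 1 = lambda * m)%N ->
  is_difference_set f lambda H <-> forall s, (0 < s < m)%N -> T s = 0.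
Proof.
move=> f_lambda.
have m0 : m%:R != 0 :> C by rewrite pnatr_eq0 -lt0n mchar_order_gt0.
split=> [[_ diff] r r_int|T0]; last first.
  split=> [|a a0]; first exact: card_nz_powers.
  apply/eqP; rewrite -(eqr_nat C) -(inj_eq (mulfI m0)); apply/eqP.
  rewrite difference_count_expansion // f_lambda natrM mulrC big1_seq ?addr0 //.
  by move=> s; rewrite mem_index_iota => /= /T0 ->; rewrite mulr0.
(* Multiply the expansion by chi a ^ (- r) and sum over a: the constant part
   dies by orthogonality, and so do all terms with s != r. *)
have twist0 : \sum_(a : F | a != 0) chi a ^ (- r%:Z) = 0.
  by apply: mchar_exp_sum; rewrite abszN.
have : \sum_(a | a != 0) m%:R * (difference_count a)%:R * chi a ^ (- r%:Z) = 0.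
  under eq_bigr => a a0 do rewrite /difference_count diff //.
  by rewrite -mulr_sumr twist0 mulr0.
under eq_bigr => a a0 do rewrite difference_count_expansion // mulrDl mulr_suml.
rewrite big_split /= -mulr_sumr twist0 mulr0 add0r exchange_big /=.
rewrite (bigD1_seq r) ?iota_uniq ?mem_index_iota //= [X in _ + X]big1_seq.
  rewrite addr0 (eq_bigr (fun _ => T r)) => [|a a0]; last first.
    by rewrite -invr_expz -exprnP mulrAC divff ?mul1r ?expf_neq0 ?mchar_neq0.
  (* What is left is m * f * T r = 0, and f = 0 is excluded by 1 \in H. *)
  rewrite sumr_const card_nonzero => /eqP; rewrite mulrn_eq0 => /orP[|/eqP//].
  rewrite muln_eq0 -leqn0 leqNgt mchar_order_gt0 /= => /eqP f0.
  have := cardD1 1 H; rewrite card_nz_powers f0 mem_nz_powers.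
  by rewrite oner_eq0 mchar1 // eqxx.
move=> s /andP[sr]; rewrite mem_index_iota => /andP[s1 sm].
rewrite (eq_bigr (fun a => T s * chi a ^ (s%:Z - r%:Z))) => [|a a0].
  case/andP: r_int => _ rm.
  by rewrite -mulr_sumr mchar_exp_sum ?mulr0 // absz_sub_lt.
by rewrite expfzDr ?mchar_neq0 // -exprnP; ring.
Qed.

(** * The Gauss sum equations *)

Section GaussSums.
Variable psi : F -> C.
Hypothesis psiD : {morph psi : x y / x + y >-> x * y}.
Hypothesis psi0 : psi 0 = 1.
Hypothesis psi_nontrivial : exists x, psi x != 1.

Local Notation G := (fun s : int => gen_gauss_sum psi (e s)).
Local Notation Gstar := (fun s : int => \sum_(x | x != 0) chi x ^ s * psi x).

Lemma gauss_sum_units s : (0 < `|s| < m)%N -> G s = Gstar s.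
Proof.
move=> s_int; rewrite /gen_gauss_sum (bigD1 0) //=.
rewrite (nontrivial_mchar0 (mchar_exp_mchar chiP s)) ?mchar_exp_nontrivial //.
by rewrite mul0r add0r; apply: eq_bigr => x x0; rewrite mchar_expE.
Qed.

(** For the trivial character Gstar and G differ: the term at 0, which is 1 by
the extension rule, cancels the sum -1 over nonzero arguments. *)
Lemma gauss_sum_units0 : Gstar 0 = -1.
Proof.
have := additive_char_sum psiD psi_nontrivial; rewrite (bigD1 0) //= psi0.
move=> /eqP; rewrite addrC addr_eq0 => /eqP <-.
by apply: eq_bigr => x _; rewrite expr0z mul1r.
Qed.

(** Substitute x = - y h in the product over (x, y): the powers of chi y combine
to chi y ^ s, the sign cancels chi (-1) ^ t, and psi (x + y) = psi ((1 - h) y)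
makes the inner sum over y a twisted Gauss sum of chi^s. This is uniform in t,
including t = 0 and t = s. *)
Lemma gauss_sum_product (s t : nat) : (0 < s < m)%N ->
  chi (-1) ^+ t * Gstar t%:Z * Gstar (s%:Z - t%:Z)
    = G s%:Z * \sum_(h | h != 0) chi h ^+ t * (e s (1 - h))^-1.
Proof.
move=> s_int; have ntriv := @mchar_exp_nontrivial s s_int.
have chie := mchar_exp_mchar chiP s%:Z.
transitivity (\sum_(h | h != 0) chi h ^+ t *
    \sum_(y | y != 0) chi y ^+ s * psi ((1 - h) * y)); last first.
  rewrite mulr_sumr; apply: eq_bigr => h h0; rewrite [RHS]mulrCA.
  congr (_ * _); rewrite [RHS]mulrC -(gauss_sum_twist psi0 chie ntriv).
  rewrite [RHS](bigD1 0) //= (nontrivial_mchar0 chie ntriv).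
  by rewrite mul0r add0r; apply: eq_bigr => y y0; rewrite mchar_expE.
under [RHS]eq_bigr do rewrite mulr_sumr.
rewrite exchange_big /= mulr_sumr; apply: eq_bigr => y y0.
have Ny0 : - y != 0 by rewrite oppr_eq0.
rewrite (reindex_inj (mulfI Ny0)) /= mulr_sumr mulr_suml.
apply: eq_big => h; first by rewrite mulf_eq0 negb_or Ny0.
rewrite mulf_eq0 negb_or Ny0 => /= h0.
have -> : psi ((1 - h) * y) = psi (- y * h) * psi y.
  by rewrite -psiD; congr psi; ring.
rewrite -[- y]mulN1r !(mcharM chiP) ?mulf_neq0 ?oppr_eq0 ?oner_eq0 //.
rewrite expfzDr ?mchar_neq0 // -invr_expz -!exprnP !exprMn.
have chiN : chi (-1) ^+ t * chi (-1) ^+ t = 1.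
  rewrite -exprMn -mcharM ?oppr_eq0 ?oner_eq0 // mulrNN mulr1 mchar1 //.
  exact: expr1n.
have chiy : chi y ^+ t * (chi y ^+ t)^-1 = 1.
  by rewrite divff ?expf_neq0 ?mchar_neq0.
transitivity ((chi (-1) ^+ t * chi (-1) ^+ t) * (chi y ^+ t * (chi y ^+ t)^-1) *
  (chi h ^+ t * (chi y ^+ s * (psi (-1 * y * h) * psi y)))); first by ring.
by rewrite chiN chiy !mul1r.
Qed.

(** The left-hand side is the sum over all 0 <= t < m of the products of
[gauss_sum_product]: the subtracted term accounts for t = 0 and t = s, where
Gstar of the trivial character is -1. Summed over t, the factor chi h ^ t
becomes m times the indicator of H. *)
Lemma gauss_sum_identity s : (0 < s < m)%N ->
  \sum_(1 <= t < m | t != s)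
     e t%:Z (-1) * G t%:Z * G (s%:Z - t%:Z) - (1 + e s%:Z (-1)) * G s%:Z
  = m%:R * G s%:Z * T s.
Proof.
move=> s_int; have N1 : -1 != 0 :> F by rewrite oppr_eq0 oner_eq0.
transitivity (\sum_(0 <= t < m)
    chi (-1) ^+ t * Gstar t%:Z * Gstar (s%:Z - t%:Z)).
  rewrite big_ltn ?mchar_order_gt0 //.
  rewrite (bigD1_seq s) ?iota_uniq ?mem_index_iota //=.
  rewrite expr0 mul1r subr0 subrr gauss_sum_units0.
  rewrite -(@gauss_sum_units s) // mchar_expE //.
  rewrite [in LHS]addrC addrA; congr (_ + _); first by rewrite -exprnP; ring.
  rewrite big_seq_cond [RHS]big_seq_cond; apply: eq_bigr => t.
  rewrite mem_index_iota => /andP[t_int ts]; rewrite mchar_expE // -exprnP.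
  rewrite !gauss_sum_units //.
  case/andP: s_int t_int => _ sm /andP[_ tm].
  by rewrite absz_sub_lt // eq_sym.
under eq_bigr do rewrite gauss_sum_product //.
rewrite -mulr_sumr exchange_big /= [X in X * T s]mulrC -mulrA; congr (_ * _).
rewrite /T mulr_sumr big_mkcond [RHS]big_mkcond; apply: eq_bigr => h _.
rewrite -mulr_suml; case: eqVneq => [->|h0] /=.
  by rewrite mem_nz_powers eqxx.
by rewrite nz_powers_indicator //; case: ifP => //; rewrite mul0r.
Qed.

Lemma difference_set_gauss_sum lambda : (f - 1 = lambda * m)%N ->
  is_difference_set f lambda H <->
  forall s, (0 < s < m)%N ->
    \sum_(1 <= t < m | t != s) e t%:Z (-1) * G t%:Z * G (s%:Z - t%:Z)
    = (1 + e s%:Z (-1)) * G s%:Z.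
Proof.
move=> f_lambda.
have m0 : m%:R != 0 :> C by rewrite pnatr_eq0 -lt0n mchar_order_gt0.
rewrite (difference_set_shifted_char_sum f_lambda).
split=> vanish s s_int; have := gauss_sum_identity s_int.
  by rewrite vanish // mulr0 => /eqP; rewrite subr_eq0 => /eqP.
rewrite vanish // subrr => /esym/eqP; rewrite !mulf_eq0 (negPf m0) /=.
rewrite (negPf (gauss_sum_neq0 _ _ _ _ _)) //=; first by move/eqP.
  exact: mchar_exp_mchar.
exact: mchar_exp_nontrivial.
Qed.

End GaussSums.
End PowerResidues.

(** * The additive character given by the absolute trace *)

Section CanonicalAdditiveCharacter.
Variables (R : realType) (F : finFieldType) (p : nat).
Hypothesis charFp : p \in [pchar F].
Local Notation L := (pPrimeCharType charFp).
Local Notation tr := (absolute_trace charFp).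

Let p_prime : prime p := pcharf_prime charFp.

Lemma absolute_traceD : {morph tr : x y / x + y}.
Proof.
move=> x y; apply: (fmorph_inj (in_alg L)) => /=.
by rewrite scalerDl !absolute_traceE -raddfD.
Qed.

(** The trace is a sum of distinct automorphisms, so it is not identically zero
by the linear independence of characters. *)
Lemma absolute_trace_nontrivial : exists x : F, tr x != 0.
Proof.
have gal1 : 1%g \in 'Gal({:L} / 1%AS)%g by exact: group1.
have [a _] := @gal_independent_contra _ L {:L}%AS
  (fun x => x \in 'Gal({:L} / 1%AS)%g) (fun _ => 1) 1%g gal1 (oner_neq0 L).
have -> : \sum_(x in 'Gal({:L} / 1%AS)%g) 1 * x a
    = galTrace 1%AS {:L}%AS a.
  by apply: eq_bigr => x _; exact: mul1r.
move=> tra; exists (a : F); apply: contra tra => /eqP tr0.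
by have := absolute_traceE charFp a; rewrite tr0 scale0r => /esym/eqP.
Qed.

Lemma zetaXn (n : nat) :
  zeta R p ^+ n
    = cos (2 * pi / p%:R * n%:R) +i* sin (2 * pi / p%:R * n%:R).
Proof.
elim: n => [|n IH]; first by rewrite expr0 mulr0 cos0 sin0.
rewrite exprS IH; set th := 2 * pi / p%:R.
have -> : th * n.+1%:R = th + th * n%:R by rewrite -nat1r mulrDr mulr1.
by rewrite cosD sinD /zeta -/th; congr (_ +i* _); ring.
Qed.

Lemma zeta_expp : zeta R p ^+ p = 1.
Proof.
have p0 : p%:R != 0 :> R by rewrite pnatr_eq0 -lt0n prime_gt0.
by rewrite zetaXn divfK // mulr_natl cos2pi sin2pi.
Qed.

(** The angle 2 pi / p lies in (0, pi], where the cosine is injective. *)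
Lemma zeta_neq1 : zeta R p != 1.
Proof.
have p_gt0 : 0 < p%:R :> R by rewrite ltr0n prime_gt0.
have p_ge2 : 2 <= p%:R :> R by rewrite ler_nat prime_gt1.
have pi_gt0 := pi_gt0 R.
apply/eqP => -[cos1 _].
have th_int : 2 * pi / p%:R \in `[0, pi : R].
  rewrite in_itv /=; apply/andP; split.
    by rewrite divr_ge0 ?mulr_ge0 // ltW.
  by rewrite ler_pdivrMr // mulrC ler_pM2l.
have := cos_inj th_int _ (etrans cos1 (esym (@cos0 R))).
rewrite in_itv /= lexx ltW // => /(_ isT)/eqP.
by rewrite !mulf_eq0 invr_eq0 pnatr_eq0 !gt_eqF.
Qed.

Definition canonical_char (x : F) : R[i] := zeta R p ^+ tr x.

Lemma canonical_charD :
  {morph canonical_char : x y / x + y >-> x * y}.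
Proof.
move=> x y; rewrite /canonical_char absolute_traceD /= expr_mod ?exprD //.
by rewrite Fp_cast // zeta_expp.
Qed.

Lemma canonical_char0 : canonical_char 0 = 1.
Proof.
have tr0 : tr 0 = 0 by apply: (addrI (tr 0)); rewrite -absolute_traceD !addr0.
by rewrite /canonical_char tr0.
Qed.

(** Since p is prime and zeta != 1, zeta has exact order p, and a nonzero trace
is represented by an exponent strictly between 0 and p. *)
Lemma canonical_char_nontrivial : exists x, canonical_char x != 1.
Proof.
have [x trx] := absolute_trace_nontrivial; exists x.
apply/eqP; rewrite /canonical_char => zx.
have [d prim_d d_dvd_p] := prim_order_exists (prime_gt0 p_prime) zeta_expp.
have [_ /(_ d d_dvd_p)/orP[/eqP d1|/eqP dp]] := primeP p_prime.
  by have := zeta_neq1; rewrite -(prim_expr_order prim_d) d1 expr1 eqxx.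
have := prim_order_dvd prim_d (tr x); rewrite zx eqxx dp gtnNdvd //.
  by rewrite lt0n; apply: contra trx => /eqP tr0; apply/eqP/val_inj.
by rewrite -[X in (_ < X)%N](Fp_cast p_prime) ltn_ord.
Qed.

End CanonicalAdditiveCharacter.

Theorem theorem3p3 (R : realType) (F : finFieldType) (p q m f lambda : nat)
    (charFp : p \in [pchar F]) (cardF : #|F| = q)
    (m_gt0 : (0 < m)%N) (f_gt0 : (0 < f)%N)
    (q_mf : q = (m * f + 1)%N) (f_lambda : (f - 1 = lambda * m)%N)
    (chi : F -> R[i]) (chi_char : is_mchar chi)
    (chi_order : mchar_has_order chi m) :
  is_difference_set f lambda (nz_powers F m) <->
  (forall s : nat, (1 <= s <= m - 1)%N ->
     \sum_(1 <= t < m | t != s)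
        mchar_exp chi t%:Z (-1)
          * gauss_sum charFp (mchar_exp chi t%:Z)
          * gauss_sum charFp (mchar_exp chi (s%:Z - t%:Z))
     = (1 + mchar_exp chi s%:Z (-1)) * gauss_sum charFp (mchar_exp chi s%:Z)).
Proof.
have card_mf : #|F| = (m * f + 1)%N by rewrite cardF.
have s_int s : (1 <= s <= m - 1)%N = (0 < s < m)%N.
  by rewrite subn1 -[in RHS](prednK m_gt0) ltnS.
rewrite (difference_set_gauss_sum card_mf chi_char chi_order
  (canonical_charD R charFp) (canonical_char0 R charFp)
  (canonical_char_nontrivial R charFp) f_lambda).
by split=> eqs s; [rewrite s_int | rewrite -s_int]; apply: eqs.
Qed.
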